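(* Let $\mathcal{B}$ be the set of Catalan words avoiding the pattern $(\geq,\geq)$ that do not end with two letters $ab$ satisfying $a\ge b$, and let \[ B(x,q)=\sum_{w\in\mathcal{B},\,w\ne\epsilon}x^{|w|}q^{\mathrm{area}(w)}, \] where $|w|$ is the length and $\epsilon$ the empty word. Then \[ B(x,q)=\frac{\sum_{j\geq1}(-1)^{j-1}q^{j}x^j\prod_{i=1}^{j-1}\frac{1-q^i+q^{2i}}{1-q^i}} {1-\sum_{j\geq1}(-1)^{j-1}\frac{q^{j}x^j}{1-q^j}\prod_{i=1}^{j-1}\frac{1-q^i+q^{2i}}{1-q^i}}. \] Moreover, $1+B(x,q)$ equals the infinite continued fraction \[ 1+B(x,q)=\cfrac{1}{1-\cfrac{qx}{1+qx-\cfrac{(1+qx)q^2x}{1+q^2x-\cfrac{(1+q^2x)q^3x}{\ddots}}}}, \] i.e. $1+B(x,q)=1/(1-qx/F_1)$ where $F_k=1+q^kx-\dfrac{(1+q^kx)q^{k+1}x}{F_{k+1}}$ for $k\ge1$.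
   Context: A Catalan word of length $n\ge 0$ is a sequence $w=w_1\cdots w_n$ of non-negative integers with $w_1=0$ and $0\le w_i\le w_{i-1}+1$ for $i=2,\dots,n$. It avoids the pattern $(\geq,\geq)$ if there is no index $i$ with $w_i\ge w_{i+1}\ge w_{i+2}$. $\mathrm{area}(w)=\sum_{i=1}^n(w_i+1)$, the number of cells of the bottom-aligned bargraph whose $i$-th column has $w_i+1$ cells. *)

(* Defs.v *)
From HB Require Import structures.
From mathcomp Require Import all_boot all_order all_algebra.
From mathcomp Require Import boolp classical_sets.

Set Implicit Arguments.
Unset Strict Implicit.
Unset Printing Implicit Defensive.

Import GRing.Theory.
Local Open Scope ring_scope.

(* A record rather than a bare function type, because [nat -> R] already
   carries the pointwise ring structure. *)
Record fps (R : Type) := Fps { fps_coef :> nat -> R }.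

Notation "{ 'fps' R }" := (fps R) (at level 0, format "{ 'fps'  R }").

HB.instance Definition _ (R : Type) := gen_eqMixin {fps R}.
HB.instance Definition _ (R : Type) := gen_choiceMixin {fps R}.

Lemma fpsP (R : Type) (f g : {fps R}) : f =1 g -> f = g.
Proof. by case: f g => [f] [g] /= /funext ->. Qed.

Section FpsRing.
Variable R : comNzRingType.
Implicit Types f g h : {fps R}.

Definition fps0 : {fps R} := Fps (fun=> 0).
Definition fps_opp f : {fps R} := Fps (fun n => - f n).
Definition fps_add f g : {fps R} := Fps (fun n => f n + g n).

Fact fps_addA : associative fps_add.
Proof. by move=> f g h; apply: fpsP => n /=; rewrite addrA. Qed.
Fact fps_addC : commutative fps_add.
Proof. by move=> f g; apply: fpsP => n /=; rewrite addrC. Qed.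
Fact fps_add0 : left_id fps0 fps_add.
Proof. by move=> f; apply: fpsP => n /=; rewrite add0r. Qed.
Fact fps_addN : left_inverse fps0 fps_opp fps_add.
Proof. by move=> f; apply: fpsP => n /=; rewrite addNr. Qed.

HB.instance Definition _ :=
  GRing.isZmodule.Build {fps R} fps_addA fps_addC fps_add0 fps_addN.

Definition fpsC (c : R) : {fps R} := Fps (fun n => if n == 0%N then c else 0).
Definition fpsX : {fps R} := Fps (fun n => (n == 1%N)%:R).
Definition fps_mul f g : {fps R} :=
  Fps (fun n => \sum_(i < n.+1) f i * g (n - i)%N).

Fact fps_mul_rev f g n :
  fps_mul f g n = \sum_(i < n.+1) f (n - i)%N * g i.
Proof.
rewrite /= (reindex_inj rev_ord_inj) /=.
by apply: eq_bigr => j _; rewrite (sub_ordK j).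
Qed.

Fact fps_mulC : commutative fps_mul.
Proof.
move=> f g; apply: fpsP => n; rewrite fps_mul_rev /=.
by apply: eq_bigr => i _; rewrite mulrC.
Qed.

Fact fps_mulA : associative fps_mul.
Proof.
move=> p q r; apply: fpsP => i; rewrite [RHS]fps_mul_rev.
rewrite -[LHS]/(\sum_(j < i.+1) p j * fps_mul q r (i - j)%N).
pose coef3 j k := p j * (q (i - j - k)%N * r k).
transitivity (\sum_(j < i.+1) \sum_(k < i.+1 | (k <= i - j)%N) coef3 j k).
  apply: eq_bigr => j _.
  rewrite fps_mul_rev big_distrr /=.
  by rewrite (big_ord_narrow_leq (leq_subr _ _)).
rewrite (exchange_big_dep predT) //=; apply: eq_bigr => k _.
transitivity (\sum_(j < i.+1 | (j <= i - k)%N) coef3 j k).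
  apply: eq_bigl => j; rewrite -ltnS -(ltnS j) -!subSn ?leq_ord //.
  by rewrite -subn_gt0 -(subn_gt0 j) -!subnDA addnC.
rewrite (big_ord_narrow_leq (leq_subr _ _)) big_distrl /=.
by apply: eq_bigr => j _; rewrite /coef3 -!subnDA addnC mulrA.
Qed.

Fact fps_mul1 : left_id (fpsC 1) fps_mul.
Proof.
move=> f; apply: fpsP => n /=.
by rewrite big_ord_recl /= mul1r subn0 big1 ?addr0 // => i _; rewrite mul0r.
Qed.

Fact fps_mulDl : left_distributive fps_mul fps_add.
Proof.
move=> f g h; apply: fpsP => n /=; rewrite -big_split /=.
by apply: eq_bigr => i _; rewrite mulrDl.
Qed.

Fact fps_one_neq0 : fpsC 1 != 0.
Proof.
by apply/eqP => /(congr1 (fun f : {fps R} => f 0%N)) /eqP; rewrite /= oner_eq0.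
Qed.

HB.instance Definition _ := GRing.Zmodule_isComNzRing.Build {fps R}
  fps_mulA fps_mulC fps_mul1 fps_mulDl fps_one_neq0.

Lemma fps_coef0 n : (0 : {fps R}) n = 0. Proof. by []. Qed.
Lemma fps_coef1 n : (1 : {fps R}) n = (n == 0%N)%:R.
Proof. by rewrite /=; case: n. Qed.
Lemma fps_coefN f n : (- f) n = - f n. Proof. by []. Qed.
Lemma fps_coefD f g n : (f + g) n = f n + g n. Proof. by []. Qed.
Lemma fps_coefB f g n : (f - g) n = f n - g n. Proof. by []. Qed.
Lemma fps_coefM f g n : (f * g) n = \sum_(i < n.+1) f i * g (n - i)%N.
Proof. by []. Qed.
Lemma fps_coef_sum I (r : seq I) (P : pred I) (F : I -> {fps R}) n :
  (\sum_(i <- r | P i) F i) n = \sum_(i <- r | P i) F i n.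
Proof. by elim/big_rec2: _ => [|i x y _ <-]. Qed.

(* Coefficientwise eventual stabilisation, i.e. convergence for the
   variable-adic topology. *)
Definition fps_cvg (u : nat -> {fps R}) (l : {fps R}) :=
  forall n, exists N, forall m, (N <= m)%N -> u m n = l n.

(* A coefficient that never stabilises is given the value 0. *)
Definition fps_lim (u : nat -> {fps R}) : {fps R} :=
  Fps (fun n =>
    xget 0 [set c : R | exists N, forall m, (N <= m)%N -> u m n = c]%classic).

Lemma fps_cvg_lim u l : fps_cvg u l -> fps_lim u = l.
Proof.
move=> ul; apply: fpsP => n /=; apply: xget_unique; first exact: ul.
move=> y [N HN]; have [M HM] := ul n.
by rewrite -(HN (maxn N M)) ?leq_maxl // HM ?leq_maxr.
Qed.

Definition fps_sum (k : nat) (u : nat -> {fps R}) : {fps R} :=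
  fps_lim (fun m => \sum_(k <= j < m) u j).

(* If u j is divisible by 'X^j for all j, the infinite sum converges. *)
Lemma fps_sum_cvg k (u : nat -> {fps R}) :
    (forall j n, (n < j)%N -> u j n = 0) ->
  fps_cvg (fun m => \sum_(k <= j < m) u j) (fps_sum k u).
Proof.
move=> u0; suff ul : fps_cvg (fun m => \sum_(k <= j < m) u j)
    (Fps (fun n => \sum_(k <= j < n.+1) u j n)) by rewrite /fps_sum (fps_cvg_lim ul).
move=> n; exists n.+1 => m lt_nm; rewrite fps_coef_sum /=.
case: (leqP k n.+1) => [le_kn|lt_nk].
  rewrite (big_cat_nat le_kn lt_nm) /= [X in _ + X]big_nat_cond.
  by rewrite [X in _ + X]big1 ?addr0 // => j /andP[/andP[/u0]].
rewrite [RHS]big_geq ?(ltnW lt_nk) // big_nat_cond big1 // => j.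
by case/andP=> /andP[le_kj _] _; rewrite u0 // (leq_trans _ le_kj) // ltnW.
Qed.

End FpsRing.

Arguments fpsX {R}.

Notation "\fsum_ ( k <= j ) F" := (fps_sum k (fun j => F))
  (at level 41, F at level 41, k at level 50, j name,
   format "'[' \fsum_ ( k  <=  j ) '/  '  F ']'") : ring_scope.

Section FpsUnitRing.
Variable R : comUnitRingType.
Implicit Types f g : {fps R}.

Fixpoint fps_inv_seq f (n : nat) : seq R :=
  if n is m.+1 then
    let s := fps_inv_seq f m in
    rcons s ((f 0%N)^-1 * ((m == 0%N)%:R - \sum_(i < m) s`_i * f (m - i)%N))
  else [::].

Definition fps_unit : pred {fps R} := fun f => f 0%N \is a GRing.unit.

Definition fps_inv f : {fps R} :=
  if fps_unit f then Fps (fun n => (fps_inv_seq f n.+1)`_n) else f.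

Fact size_fps_inv_seq f n : size (fps_inv_seq f n) = n.
Proof. by elim: n => //= n IHn; rewrite size_rcons IHn. Qed.

Fact nth_fps_inv_seq f n i :
  (i < n)%N -> (fps_inv_seq f n)`_i = (fps_inv_seq f i.+1)`_i.
Proof.
elim: n => // n IHn; rewrite ltnS leq_eqVlt => /predU1P[->//|lt_in].
by rewrite [LHS]/= nth_rcons size_fps_inv_seq lt_in IHn.
Qed.

Fact fps_mulV : {in fps_unit, left_inverse 1 fps_inv *%R}.
Proof.
move=> f Uf; apply: fpsP => n; have Uf0 : f 0%N \is a GRing.unit by [].
rewrite fps_coefM fps_coef1 /fps_inv [fps_unit f]Uf0 big_ord_recr subnn.
rewrite /= nth_rcons size_fps_inv_seq ltnn eqxx.
rewrite mulrAC mulVr // mul1r addrC -[RHS](subrK (\sum_(i < n)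
  (fps_inv_seq f n)`_i * f (n - i)%N)); congr (_ + _).
by apply: eq_bigr => i _; rewrite [in RHS]nth_fps_inv_seq.
Qed.

Fact fps_unitPl f g : g * f = 1 -> fps_unit f.
Proof.
move=> /(congr1 (fun h : {fps R} => h 0%N)).
rewrite fps_coefM big_ord1 fps_coef1 subnn eqxx => gf1.
by apply/unitrP; exists (g 0%N); split=> //; rewrite mulrC.
Qed.

Fact fps_inv_out : {in [predC fps_unit], fps_inv =1 id}.
Proof. by move=> f /negPf nUf; rewrite /fps_inv [fps_unit f]nUf. Qed.

HB.instance Definition _ := GRing.ComNzRing_hasMulInverse.Build {fps R}
  fps_mulV fps_unitPl fps_inv_out.

Lemma fps_unitE f : (f \is a GRing.unit) = (f 0%N \is a GRing.unit).
Proof. by []. Qed.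

End FpsUnitRing.

Local Open Scope nat_scope.

Definition catalan (w : seq nat) : bool :=
  (head 0 w == 0) && sorted (fun a b => b <= a.+1) w.

Definition avoids_geq_geq (w : seq nat) : Prop :=
  ~ exists i, [/\ i.+2 < size w,
                  nth 0 w i >= nth 0 w i.+1 & nth 0 w i.+1 >= nth 0 w i.+2].

Definition ends_geq (w : seq nat) : Prop :=
  exists u a b, w = u ++ [:: a; b] /\ a >= b.

Definition in_calB (w : seq nat) : Prop :=
  [/\ catalan w, avoids_geq_geq w & ~ ends_geq w].

Definition area (w : seq nat) : nat := \sum_(a <- w) a.+1.

Lemma catalan_letter_lt w a : catalan w -> a \in w -> a < size w.
Proof.
case: w => // b w /andP[/= /eqP-> {b}] pw; rewrite inE => /predU1P[->//|].
suff H : forall c, path (fun a b => b <= a.+1) c w -> a \in w ->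
    a <= c + size w by move=> /(H 0 pw); rewrite add0n.
elim: w {pw} => // b w IHw c /= /andP[le_bc pw].
rewrite inE => /predU1P[->|aw].
  by apply: leq_trans le_bc _; rewrite addnS ltnS leq_addr.
by apply: leq_trans (IHw b pw aw) _; rewrite addnS -addSn leq_add2r.
Qed.

Local Open Scope ring_scope.

(* Z[[q]][[x]]: the outer variable is x, and q is the variable of the
   coefficient ring. *)
Notation Zqx := {fps {fps int}}.

Definition x_ : Zqx := fpsX.
Definition q_ : Zqx := fpsC fpsX.

(* The words of length n are taken in n.-tuple 'I_n, which loses none of them
   by catalan_letter_lt; starting at n = 1 leaves out the empty word. *)
Definition genB : Zqx :=
  \fsum_(1 <= n)
    \sum_(w : n.-tuple 'I_n | `[< in_calB [seq val i | i <- w] >])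
      x_ ^+ n * q_ ^+ area [seq val i | i <- w].

(* F_k cut off after d steps: the fraction containing F_{k+d+1} is dropped. *)
Fixpoint cf_tail (d k : nat) : Zqx :=
  if d is d'.+1 then
    1 + q_ ^+ k * x_
      - (1 + q_ ^+ k * x_) * q_ ^+ k.+1 * x_ / cf_tail d' k.+1
  else 1 + q_ ^+ k * x_.

Definition cf_convergent (d : nat) : Zqx := 1 / (1 - q_ * x_ / cf_tail d 1).

(* Main.v *)
(* Let A(x) = 1 + B(x, q), and let Q(x) count the words of calB that are empty
   or start with 01. Cutting a nonempty word before its second 0 writes it
   uniquely as 0 (u+1) v with u in calB and v counted by Q, so
   A(x) = 1 + q x A(q x) Q(x). A word of calB is either counted by Q or of the
   form 0 v with v counted by Q, so A(x) = (1 + q x) Q(x). Eliminating Q,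
     A(x) (1 + q x) = 1 + q x + q x A(q x) A(x).
   Hence F_k = (1 + q^k x) / A(q^k x) satisfies the continued fraction
   recursion, and each convergent gains one order in x. The same equation is
   linearised by A(x) = D(q x) / D(x): if D is the denominator in the theorem,
   then the numerator is D(q x) - D(x), and comparing coefficients yields
     (1 + q x) D(x) = (1 + q x) D(q x) - q x D(q^2 x). *)
Require Import Defs.
From mathcomp Require Import all_boot all_order all_algebra.
From HB Require Import structures.
From mathcomp Require Import boolp ring zify.

Set Implicit Arguments.
Unset Strict Implicit.
Unset Printing Implicit Defensive.

Local Open Scope ring_scope.
Import GRing.Theory.

(** * Power series: coefficients, rescaling of the variable, order of vanishing *)

Section PowerSeries.
Variable R : comNzRingType.
Implicit Types (c : R) (f g : {fps R}).

Lemma fps_coefCM c f n : (fpsC c * f) n = c * f n.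
Proof.
rewrite fps_coefM big_ord_recl /= subn0 big1 ?addr0 // => i _.
by rewrite mul0r.
Qed.

Lemma fps_coefXM f n : (fpsX * f) n = if n is m.+1 then f m else 0.
Proof.
rewrite fps_coefM; case: n => [|n]; first by rewrite big_ord1 mul0r.
rewrite big_ord_recl mul0r add0r big_ord_recl /= mul1r subSS subn0.
by rewrite big1 ?addr0 // => i _; rewrite mul0r.
Qed.

Lemma fps_coefXnM f k n :
  (fpsX ^+ k * f) n = if (k <= n)%N then f (n - k)%N else 0.
Proof.
elim: k n => [|k IHk] n; first by rewrite expr0 mul1r subn0.
by rewrite exprS -mulrA fps_coefXM; case: n => [|n] //; rewrite IHk ltnS subSS.
Qed.

Fact fpsC_zmod_morphism : zmod_morphism (@fpsC R).
Proof.
by move=> a b; apply: fpsP => n; rewrite fps_coefB /=; case: eqP; rewrite ?subr0.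
Qed.

Fact fpsC_monoid_morphism : monoid_morphism (@fpsC R).
Proof.
split=> // a b; apply: fpsP => n; rewrite fps_coefCM /=.
by case: eqP; rewrite ?mulr0.
Qed.

HB.instance Definition _ :=
  GRing.isZmodMorphism.Build R {fps R} (@fpsC R) fpsC_zmod_morphism.
HB.instance Definition _ :=
  GRing.isMonoidMorphism.Build R {fps R} (@fpsC R) fpsC_monoid_morphism.

(** The substitution f(x) -> f(cx); with c = q it is the dilation x -> qx. *)
Definition fps_scale c f : {fps R} := Fps (fun n => c ^+ n * f n).

Fact fps_scale_zmod_morphism c : zmod_morphism (fps_scale c).
Proof. by move=> f g; apply: fpsP => n; rewrite /= mulrBr. Qed.

Fact fps_scale_monoid_morphism c : monoid_morphism (fps_scale c).
Proof.
split=> [|f g]; apply: fpsP => n.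
  by rewrite [LHS]/= !fps_coef1; case: n => [|n]; rewrite ?mulr0 ?mul1r.
rewrite [LHS]/= fps_coefM big_distrr; apply: eq_bigr => i _ /=.
by rewrite -{1}(subnKC (leq_ord i)) exprD mulrACA.
Qed.

HB.instance Definition _ c :=
  GRing.isZmodMorphism.Build {fps R} {fps R} (fps_scale c)
    (fps_scale_zmod_morphism c).
HB.instance Definition _ c :=
  GRing.isMonoidMorphism.Build {fps R} {fps R} (fps_scale c)
    (fps_scale_monoid_morphism c).

Lemma fps_scaleC c a : fps_scale c (fpsC a) = fpsC a.
Proof. by apply: fpsP => -[|n] /=; rewrite ?mul1r ?mulr0. Qed.

Lemma fps_scaleX c : fps_scale c fpsX = fpsC c * fpsX.
Proof. by apply: fpsP => -[|[|n]]; rewrite fps_coefCM /= ?mulr0. Qed.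

Definition vanish m f := forall n, (n < m)%N -> f n = 0.

Lemma vanish0 f : vanish 0 f. Proof. by []. Qed.

Lemma vanishD m f g : vanish m f -> vanish m g -> vanish m (f + g).
Proof. by move=> f0 g0 n lt_nm; rewrite fps_coefD f0 // g0 // addr0. Qed.

Lemma vanishMl m f g : vanish m g -> vanish m (f * g).
Proof.
move=> g0 n lt_nm; rewrite fps_coefM big1 // => i _.
by rewrite g0 ?mulr0 // (leq_ltn_trans (leq_subr _ _)).
Qed.

Lemma vanishX m f : vanish m f -> vanish m.+1 (fpsX * f).
Proof. by move=> f0 [|n] lt_nm; rewrite fps_coefXM // f0. Qed.

Lemma vanish_scale m c f : vanish m f -> vanish m (fps_scale c f).
Proof. by move=> f0 n /f0 /= ->; rewrite mulr0. Qed.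

Lemma vanish_eq0 f : (forall m, vanish m f) -> f = 0.
Proof. by move=> f0; apply: fpsP => n; apply: (f0 n.+1). Qed.

Lemma vanish_cvg (u : nat -> {fps R}) f :
  (forall d, vanish d (u d - f)) -> fps_cvg u f.
Proof.
move=> uf n; exists n.+1 => m lt_nm.
by apply/eqP; rewrite -subr_eq0 -fps_coefB uf.
Qed.

(** Each term is a single monomial, so the coefficient of x^n receives only the term j = n. This
    serves both the sums of the theorem and [genB]. *)
Lemma fps_sumXM (u : nat -> {fps R}) (c : nat -> R) :
    (forall j, u j.+1 = fpsX ^+ j.+1 * fpsC (c j.+1)) ->
  \fsum_(1 <= j) u j = Fps (fun n => if n is 0%N then 0 else c n).
Proof.
move=> uE; apply: fps_cvg_lim => n; exists n.+1 => m lt_nm.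
rewrite fps_coef_sum big_add1.
under eq_bigr => j _ do rewrite uE fps_coefXnM.
case: n lt_nm => [|n] lt_nm; first by rewrite big1.
rewrite (bigD1_seq n) ?mem_index_iota ?iota_uniq //=; last by case: m lt_nm.
rewrite leqnn subnn /= big1 ?addr0 // => j ne_jn.
case: leqP => //; rewrite ltnS => le_jn; rewrite subSS /= subn_eq0.
by rewrite leqNgt ltn_neqAle ne_jn le_jn.
Qed.

End PowerSeries.

Section UnitPowerSeries.
Variable R : comUnitRingType.

Lemma vanishBV m (f g : {fps R}) :
    f \is a GRing.unit -> g \is a GRing.unit -> vanish m (f - g) ->
  vanish m (f^-1 - g^-1).
Proof.
move=> Uf Ug fg.
have -> : f^-1 - g^-1 = - (f^-1 * g^-1) * (f - g).
  by rewrite mulNr mulrBr mulrAC mulVr // mul1r mulrVK // opprB.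
exact: vanishMl.
Qed.

End UnitPowerSeries.

(** * Words: a letter-by-letter test and the cut before the second 0 *)

Local Open Scope nat_scope.

(* [calB_from d a s]: [s] may follow the letter [a], where [d] records that [a]
   was reached by a weak descent, so that the next step must be an ascent. *)
Fixpoint calB_from (d : bool) (a : nat) (s : seq nat) : bool :=
  if s is b :: s' then
    if b <= a then ~~ d && calB_from true b s'
    else (b == a.+1) && calB_from false b s'
  else ~~ d.

Definition calB (w : seq nat) : bool :=
  if w is a :: s then (a == 0) && calB_from false 0 s else true.

(* The words of calB that are empty or start with 01. *)
Definition calQ (w : seq nat) : bool :=
  if w is a :: s then (a == 0) && calB_from true 0 s else true.

Lemma avoids_geq_geq_cons2 a b s :
  avoids_geq_geq [:: a, b & s] <->
  avoids_geq_geq (b :: s) /\ (b <= a -> s = [::] \/ b < head 0 s).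
Proof.
split=> [av|[av ab] [[|i] []] /=].
- split=> [[i [i1 i2 i3]]|le_ba]; first by apply: av; exists i.+1.
  case: s av => [|c s] av; [by left | right; rewrite ltnNge].
  by apply/negP => le_cb; apply: av; exists 0.
- case: s {av} ab => [|c s] //= ab _ /ab[] // lt_bc.
  by rewrite leqNgt lt_bc.
- by rewrite ltnS => i1 i2 i3; apply: av; exists i.
Qed.

Lemma ends_geq_cons2 a b s :
  ends_geq [:: a, b & s] <-> (s = [::] /\ b <= a) \/ ends_geq (b :: s).
Proof.
split=> [[[|x u] [c [d [/= e le_dc]]]]|[[-> le_ba]|[u [c [d [e le_dc]]]]]].
- by case: e le_dc => -> -> -> le_dc; left.
- by case: e => _ ->; right; exists u, c, d.
- by exists [::], a, b.
- by exists (a :: u), c, d; rewrite e.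
Qed.

Lemma calB_fromP d a s :
  calB_from d a s <->
  [/\ path (fun a b => b <= a.+1) a s, avoids_geq_geq (a :: s),
      ~ ends_geq (a :: s) & d -> a < head 0 s].
Proof.
elim: s d a => [|b s IHs] d a /=.
  split=> [nd|[_ _ _]]; last by case: d => // /(_ isT).
  split=> [||[[|x [|y u]] [c [e []]]]|] //; first by case=> i [].
  by rewrite (negPf nd).
rewrite (propext (avoids_geq_geq_cons2 a b s)) (propext (ends_geq_cons2 a b s)).
case: ifPn => [le_ba|]; last rewrite -ltnNge => lt_ab.
  split=> [/andP[nd /IHs[p av en hs]]|[/andP[_ p] [av ab] en lt_ab]].
    rewrite (leq_trans le_ba) //; split=> //; last by rewrite (negPf nd).
      by split=> // _; right; apply: hs.
    by case=> [[s0 _]|//]; move: (hs isT); rewrite s0.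
  have -> : d = false by apply/negP => /lt_ab; rewrite ltnNge le_ba.
  apply/IHs; split=> // [|_]; first by move=> e; apply: en; right.
  by case: (ab isT) => // s0; case: en; left.
split=> [/andP[/eqP-> /IHs[p av en _]]|[/andP[le_ba p] [av _] en _]].
  rewrite leqnn; split=> //.
  by case=> [[]|//].
rewrite eqn_leq le_ba lt_ab; apply/IHs; split=> // e.
by apply: en; right.
Qed.

Lemma calBP w : calB w <-> in_calB w.
Proof.
case: w => [|a s] /=.
  split=> // _; split=> //; first by case=> i [].
  by case=> [[|x u]] [b [c []]].
rewrite /in_calB /catalan /=; split=> [/andP[/eqP-> /calB_fromP[]] //|].
case=> /andP[/eqP a0 p] av en; rewrite a0 eqxx.
by apply/calB_fromP; split=> //; rewrite -a0.
Qed.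

Lemma calB_catalan w : calB w -> catalan w.
Proof. by case/calBP. Qed.

Lemma calQ_calB w : calQ w -> calB w.
Proof.
by case: w => // a [|[|b] s] //= /andP[-> ]; rewrite /= ?andbF ?andbT.
Qed.

(** A second 0 is a weak descent and sets the flag, which is the state where [calQ] begins;
    otherwise the word is [0] or starts with 01. *)
Lemma calB_cons v : calB (0 :: v) = calQ v || calQ (0 :: v).
Proof. by case: v => [|[|b] s] //=; rewrite ?andbF ?orbF. Qed.

(** The 0 opening [v] lies below the shifted letters, so it is a weak descent: it needs a clear
    flag, just as the end of [s] does, and leaves the flag set, as [calQ] expects. *)
Lemma calB_from_shift d a s v :
    head 0 v = 0 ->
  calB_from d a.+1 (map S s ++ v) = calB_from d a s && calQ v.
Proof.
move=> v0; elim: s d a => [|b s IHs] d a /=.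
  by case: v v0 => [|c v] /= => [|->]; rewrite ?andbT.
by rewrite ltnS eqSS !IHs; case: ifP; rewrite andbA.
Qed.

Lemma calB_first_return u v :
  head 0 v = 0 -> calB (0 :: map S u ++ v) = calB u && calQ v.
Proof.
case: u => [|b u] v0 /=; first by case: v v0 => [|c v] //= ->.
rewrite eqSS calB_from_shift //.
by case: b => [|b].
Qed.

Lemma first_return w : exists u v, w = map S u ++ v /\ head 0 v = 0.
Proof.
elim: w => [|[|a] w [u [v [-> v0]]]]; first by exists [::], [::].
  by exists [::], (0 :: map S u ++ v).
by exists (a :: u), v.
Qed.

(** The shifted block is the longest prefix of positive letters, hence determined by the word. *)
Lemma first_return_inj u v u' v' :
    head 0 v = 0 -> head 0 v' = 0 ->
  map S u ++ v = map S u' ++ v' -> u = u' /\ v = v'.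
Proof.
move=> v0 v0'; elim: u u' => [|a u IHu] [|a' u'] //=.
- by move=> e; rewrite e in v0.
- by move=> e; rewrite -e in v0'.
- by case=> -> /IHu[-> ->].
Qed.

Lemma calQ_head v : calQ v -> head 0 v = 0.
Proof. by case: v => //= a v /andP[/eqP]. Qed.

Lemma area_cons a w : area (a :: w) = a.+1 + area w.
Proof. by rewrite /area big_cons. Qed.

Lemma area_first_return u v :
  area (0 :: map S u ++ v) = (size u + area u + area v).+1.
Proof.
rewrite area_cons; congr _.+1; rewrite /area big_cat big_map; congr (_ + _).
by elim: u => [|a u IHu]; rewrite ?big_nil // !big_cons IHu /=; lia.
Qed.

(** * Enumeration by length and the functional equations *)

Definition words n : seq (seq nat) :=
  [seq [seq val i | i <- val t] | t : n.-tuple 'I_n].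

Lemma words_uniq n : uniq (words n).
Proof.
rewrite map_inj_uniq ?enum_uniq // => s t /(inj_map val_inj); exact: val_inj.
Qed.

Lemma mem_words n w :
  calB w -> (w \in words n) = (size w == n).
Proof.
move=> /calB_catalan cw; apply/mapP/eqP => [[t _ ->]|sw].
  by rewrite size_map size_tuple.
(* [inord] needs a nonempty range, so length 0 is treated apart. *)
case: n sw => [|n] sw; first by exists [tuple]; rewrite ?mem_enum // (size0nil sw).
have st : size [seq inord i : 'I_n.+1 | i <- w] == n.+1 by rewrite size_map sw.
exists (Tuple st); rewrite ?mem_enum //= -map_comp -[LHS]map_id.
by apply/eq_in_map => i /(catalan_letter_lt cw) lt_iw; rewrite /= inordK -?sw.
Qed.

Local Open Scope ring_scope.

Definition gf (S : pred (seq nat)) : Zqx :=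
  Fps (fun n => \sum_(w <- words n | S w) fpsX ^+ area w).

Notation dilate := (fps_scale fpsX).

(** Reduces each decomposition of words to a duplicate-free list with the right members. *)
Lemma perm_filter_words (S : pred (seq nat)) n s :
    subpred S calB -> uniq s ->
    (forall w, (w \in s) = S w && (size w == n)) ->
  perm_eq [seq w <- words n | S w] s.
Proof.
move=> SB us smem; apply: uniq_perm; rewrite ?filter_uniq ?words_uniq //.
move=> w; rewrite mem_filter smem; case: (boolP (S w)) => // /SB cw.
by rewrite mem_words.
Qed.

Lemma mem_filter_words (S : pred (seq nat)) n w :
  subpred S calB -> (w \in [seq w <- words n | S w]) = S w && (size w == n).
Proof.
by move=> SB; rewrite mem_filter; case: (boolP (S w)) => // /SB /mem_words->.
Qed.

Lemma gf0 S : subpred S calB -> S [::] -> gf S 0%N = 1.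
Proof.
move=> SB S0; rewrite /= -big_filter (perm_big [:: [::]]).
  by rewrite big_seq1 /area big_nil expr0.
apply: perm_filter_words => // w; rewrite inE.
by case: w => [|a w]; rewrite ?S0 // andbF.
Qed.

Lemma gf_calB_calQ : gf calB = (1 + q_ * x_) * gf calQ.
Proof.
apply: fpsP => n; rewrite mulrDl mul1r -mulrA fps_coefD fps_coefCM fps_coefXM.
case: n => [|n]; first by rewrite mulr0 addr0 !gf0 //; apply: calQ_calB.
rewrite /= -big_filter -[X in X + _]big_filter -[X in _ * X]big_filter.
rewrite (perm_big ([seq w <- words n.+1 | calQ w] ++
           [seq 0%N :: v | v <- [seq v <- words n | calQ v]])).
  rewrite big_cat big_map /= mulr_sumr; congr (_ + _).
  by apply: eq_bigr => v _; rewrite area_cons exprS.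
apply: (perm_filter_words (S := calB)) => //.
  rewrite cat_uniq map_inj_uniq ?filter_uniq ?words_uniq //; last by move=> u v [].
  (* Disjointness: a nonempty word of [calQ] starts with 01, while [0 :: v] is [0] or starts with
     00. *)
  rewrite andbT /=; apply/hasPn => _ /mapP[v + ->] /=.
  by rewrite !mem_filter; case: v => [|[|b] v] //=; rewrite ?andbF.
move=> w; rewrite mem_cat mem_filter_words; last exact: calQ_calB.
(* The default 1 makes this cover the empty word along with words opening by a positive letter. *)
have notin_cons0 v : head 1%N v != 0%N ->
    v \in [seq 0%N :: v | v <- [seq v <- words n | calQ v]] = false.
  by move=> v0; apply/mapP => -[u _ e]; rewrite e in v0.
case: w => [|[|a] v]; try by rewrite notin_cons0 //= ?andbF.
rewrite calB_cons mem_map; last by move=> u w [].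
rewrite mem_filter_words; last exact: calQ_calB.
by rewrite eqSS -andb_orl orbC.
Qed.

(** The pieces are sorted by [i], the size of [u]; the leading 0 accounts for the remaining letter
    of [n.+1]. *)
Lemma calB_words_first_return n :
  perm_eq [seq w <- words n.+1 | calB w]
    [seq 0%N :: map S p.1 ++ p.2 | i <- index_iota 0 n.+1,
       p <- [seq (u, v) | u <- [seq u <- words i | calB u],
                          v <- [seq v <- words (n - i) | calQ v]]].
Proof.
have memL i u : (u \in [seq u <- words i | calB u]) = calB u && (size u == i).
  exact: mem_filter_words.
have memR i v : (v \in [seq v <- words i | calQ v]) = calQ v && (size v == i).
  by apply: mem_filter_words; exact: calQ_calB.
apply: (perm_filter_words (S := calB)) => //.
  apply: allpairs_uniq_dep; first exact: iota_uniq.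
    move=> i _; apply: allpairs_uniq; rewrite ?filter_uniq ?words_uniq //.
    by move=> [u v] [u' v'].
  move=> x y /allpairsPdep[i [_ [_ /allpairsP[[u v] [+ + ->]] ->]]].
  rewrite memL memR => /andP[_ /eqP su] /andP[/calQ_head v0 _].
  move=> /allpairsPdep[i' [_ [_ /allpairsP[[u' v'] [+ + ->]] ->]]].
  rewrite memL memR => /andP[_ /eqP su'] /andP[/calQ_head v0' _] /=.
  case=> /(first_return_inj v0 v0')[eu ev].
  by rewrite -su -su' /= in eu ev *; rewrite eu ev.
move=> w; apply/allpairsPdep/andP.
  case=> i [_ [+ /allpairsP[[u v] [+ + ->]] ->]].
  rewrite memL memR mem_index_iota ltnS /= => le_in /andP[Bu /eqP su].
  case/andP=> Qv /eqP sv.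
  have /= -> := calB_first_return u (calQ_head Qv).
  by rewrite Bu Qv size_cat size_map su sv subnKC.
case: w => [|a w] [] //; case: a => // + /eqP [sw].
have [u [v [ew v0]]] := first_return w.
rewrite ew size_cat size_map in sw *; rewrite calB_first_return // => /andP[Bu Qv].
exists (size u), (u, v); split=> //.
  by rewrite mem_index_iota -sw ltnS leq_addr.
by apply/allpairsP; exists (u, v); rewrite memL memR Bu Qv -sw addKn !eqxx.
Qed.

(** The sum over [i] is a Cauchy product. Raising [u] adds one cell per column, which is the factor
    q^i supplied by the dilation; the leading 0 gives qx. *)
Lemma gf_calB_first_return :
  gf calB = 1 + q_ * x_ * dilate (gf calB) * gf calQ.
Proof.
apply: fpsP => n; rewrite -!mulrA fps_coefD fps_coefCM fps_coefXM fps_coef1.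
case: n => [|n]; first by rewrite mulr0 addr0 gf0.
rewrite add0r fps_coefM mulr_sumr [LHS]/= -big_filter.
rewrite (perm_big _ (calB_words_first_return n)) big_allpairs_dep big_mkord.
apply: eq_bigr => i _; rewrite big_allpairs_dep /=.
rewrite -[X in _ ^+ i * X]big_filter -[X in _ * _ * X]big_filter -mulrA.
rewrite mulr_suml !mulr_sumr; apply: eq_big_seq => u.
rewrite mem_filter_words // => /andP[_ /eqP su].
rewrite !mulr_sumr; apply: eq_bigr => v _.
by rewrite area_first_return su exprS !exprD !mulrA.
Qed.

Lemma fpsC_Xn i : fpsC (fpsX ^+ i) = q_ ^+ i.
Proof. exact: rmorphXn. Qed.

Lemma genB_gf : 1 + genB = gf calB.
Proof.
rewrite /genB (@fps_sumXM _ _ (gf calB)) => [|j].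
  apply: fpsP => -[|n]; rewrite fps_coefD ?add0r //.
  by rewrite fps_coef1 addr0; apply/esym/gf0.
rewrite /= big_image_cond rmorph_sum mulr_sumr.
apply: eq_big => [t|t _]; first by apply/asboolP/idP => /calBP.
by rewrite -fpsC_Xn.
Qed.

Lemma gf_calB_eq :
  gf calB * (1 + q_ * x_) = 1 + q_ * x_ + q_ * x_ * dilate (gf calB) * gf calB.
Proof.
have := gf_calB_first_return; set s := dilate _ => E.
rewrite {2}gf_calB_calQ {1}E; ring.
Qed.

(** * The numerator and denominator series and their q-difference equation *)

Lemma unit_1BXn i : (0 < i)%N -> (1 - fpsX ^+ i : {fps int}) \is a GRing.unit.
Proof.
by case: i => // i _; rewrite fps_unitE fps_coefB -[fpsX ^+ _]mulr1 fps_coefXnM.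
Qed.

Lemma unit_add_x (f g : Zqx) : f 0%N = 1 -> f + g * x_ \is a GRing.unit.
Proof.
by move=> f0; rewrite fps_unitE fps_coefD mulrC fps_coefXM addr0 f0 unitr1.
Qed.

(** Kept in the inner ring Z[[q]], where [fpsX] is q, so that coefficients in x can be compared. *)
Definition qprod (j : nat) : {fps int} :=
  \prod_(1 <= i < j) ((1 - fpsX ^+ i + fpsX ^+ (2 * i)) / (1 - fpsX ^+ i)).

Definition num_coef j := (-1) ^+ (j - 1) * fpsX ^+ j * qprod j.
Definition den_coef j :=
  (-1) ^+ (j - 1) * (fpsX ^+ j / (1 - fpsX ^+ j)) * qprod j.

Definition num_series : Zqx :=
  Fps (fun n => if n is 0%N then 0 else num_coef n).
Definition den_series : Zqx :=
  1 - Fps (fun n => if n is 0%N then 0 else den_coef n).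

Lemma fpsC_1BXnV i : (0 < i)%N ->
  fpsC ((1 - fpsX ^+ i)^-1 : {fps int}) = (1 - q_ ^+ i)^-1.
Proof. by move/unit_1BXn=> U; rewrite rmorphV // rmorphB /= fpsC_Xn. Qed.

Lemma fpsC_qprod j :
  fpsC (qprod j) =
  \prod_(1 <= i < j) ((1 - q_ ^+ i + q_ ^+ (2 * i)) / (1 - q_ ^+ i)).
Proof.
rewrite rmorph_prod; apply: eq_big_nat => i /andP[i_gt0 _].
by rewrite rmorphM /= fpsC_1BXnV // rmorphD rmorphB /= !fpsC_Xn.
Qed.

Lemma num_seriesE :
  \fsum_(1 <= j)
     ((-1) ^+ (j - 1) * q_ ^+ j * x_ ^+ j *
      \prod_(1 <= i < j)
        ((1 - q_ ^+ i + q_ ^+ (2 * i)) / (1 - q_ ^+ i))) = num_series.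
Proof.
apply: fps_sumXM => j; rewrite -fpsC_qprod /num_coef !rmorphM rmorph_sign /=.
by rewrite fpsC_Xn [LHS]mulrAC [RHS]mulrC.
Qed.

Lemma den_seriesE :
  1 - \fsum_(1 <= j)
     ((-1) ^+ (j - 1) * (q_ ^+ j * x_ ^+ j / (1 - q_ ^+ j)) *
      \prod_(1 <= i < j)
        ((1 - q_ ^+ i + q_ ^+ (2 * i)) / (1 - q_ ^+ i))) = den_series.
Proof.
congr (1 - _); apply: fps_sumXM => j; rewrite -fpsC_qprod /den_coef.
rewrite !rmorphM rmorph_sign /= fpsC_1BXnV // fpsC_Xn.
have pull_x (s a b v p : Zqx) : s * (a * b * v) * p = b * (s * (a * v) * p).
  by ring.
exact: pull_x.
Qed.

Lemma num_series_dilate : num_series + den_series = dilate den_series.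
Proof.
apply: fpsP => -[|n] /=; first by rewrite subr0 add0r expr0 mul1r.
rewrite !sub0r mulrN /num_coef /den_coef; set p := qprod _; set X := _ ^+ _.+1.
have : (1 - X) * (1 - X)^-1 = 1 by apply/mulrV/unit_1BXn.
set v := (1 - X)^-1; set s := (-1) ^+ _ => H.
(* The two sides differ by a multiple of [1 - (1 - X) * v], which is zero by [H]. *)
apply: subr0_eq; transitivity (s * X * p * (1 - (1 - X) * v)); first by ring.
by rewrite H subrr mulr0.
Qed.

Lemma den_coef_num_coef j :
  (0 < j)%N -> den_coef j * (1 - fpsX ^+ j) = num_coef j.
Proof.
move=> j_gt0; rewrite /den_coef /num_coef; have := mulVr (unit_1BXn j_gt0).
set X := _ ^+ j; set v := (1 - X)^-1; set s := (-1) ^+ _; set p := qprod j.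
move=> H; have -> : s * (X / (1 - X)) * p * (1 - X) = s * X * p * (v * (1 - X)).
  by rewrite -/v; ring.
by rewrite H mulr1.
Qed.

(** The new factor i = j+1 of the product has the denominator 1 - q^(j+1) that [den_coef] already
    contains. *)
Lemma num_coef_rec j :
  num_coef j.+2 =
  - fpsX * (1 - fpsX ^+ j.+1 + fpsX ^+ (2 * j.+1)) * den_coef j.+1.
Proof.
rewrite /num_coef /den_coef /qprod big_nat_recr //= -/(qprod j.+1) !subn1 /=.
rewrite exprS [fpsX ^+ j.+2]exprS.
set X := fpsX ^+ j.+1; set Y := fpsX ^+ (2 * _); set p := qprod _.
by set v := (1 - X)^-1; set s := (-1) ^+ _; ring.
Qed.

Lemma den_series_rec n :
  den_series n.+1 * (1 - fpsX ^+ n.+1) =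
  - fpsX * (1 - fpsX ^+ n + fpsX ^+ (2 * n)) * den_series n.
Proof.
rewrite [den_series n.+1]sub0r mulNr den_coef_num_coef //.
(* At [n = 0] the constant term of D is 1, and the middle factor 1 - 1 + 1 is 1. *)
case: n => [|n]; last by rewrite num_coef_rec [den_series _]sub0r mulrN.
have -> : den_series 0%N = 1 by rewrite /= subr0.
rewrite /num_coef /qprod big_geq // muln0 !expr0 expr1 subrr add0r.
by rewrite !mulr1 mul1r.
Qed.

(** At x^(n+1), the terms carrying a factor x in D(x), D(qx) and D(q^2 x) contribute 1, q^n and
    q^(2n), which form the factor 1 - q^n + q^(2n) of the recurrence. *)
Lemma den_series_eq :
  (1 + q_ * x_) * den_series =
  (1 + q_ * x_) * dilate den_series - q_ * x_ * dilate (dilate den_series).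
Proof.
move: den_series den_series_rec => D rec.
apply: fpsP => n; rewrite !mulrDl !mul1r -!mulrA fps_coefB !fps_coefD !fps_coefCM.
rewrite !fps_coefXM; case: n => [|n] /=.
  by rewrite !mulr0 expr0 mul1r !addr0.
have := rec n; rewrite exprS mulnC exprM.
set Xn := fpsX ^+ n; set b := D n.+1; set a := D n => H.
apply: subr0_eq; transitivity (b * (1 - fpsX * Xn) -
  - fpsX * (1 - Xn + Xn ^+ 2) * a); first by ring.
by rewrite H subrr.
Qed.

(* The difference [gf calB * D - D(qx)], times a unit, equals [x] times a
   combination of itself and its dilation, so it vanishes to every order. *)
Lemma gf_calB_den : gf calB * den_series = dilate den_series.
Proof.
have := den_series_eq; have := gf_calB_eq.
set A := gf calB; set D := den_series; set sA := dilate A.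
set sD := dilate D => EA ED.
have E : (A * D - sD) * (1 + q_ * x_) =
    x_ * (q_ * (sA * (A * D - sD) + dilate (A * D - sD))).
  rewrite rmorphB rmorphM -/sA -/sD.
  set ssD := dilate sD in ED *.
  (* D times the equation for A, plus the equation for D; the products [sA * sD] cancel. *)
  apply: subr0_eq; transitivity
    (D * (A * (1 + q_ * x_) - (1 + q_ * x_ + q_ * x_ * sA * A)) +
     ((1 + q_ * x_) * D - ((1 + q_ * x_) * sD - q_ * x_ * ssD))); first by ring.
  by rewrite EA ED !subrr mulr0 addr0.
have U : 1 + q_ * x_ \is a GRing.unit by apply: unit_add_x.
apply/eqP; rewrite -subr_eq0; apply/eqP/vanish_eq0.
elim=> [|m IHm]; first exact: vanish0.
rewrite -(mulrK U (_ - _)) E mulrC; apply/vanishMl/vanishX/vanishMl/vanishD.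
  exact: vanishMl.
exact: vanish_scale.
Qed.

(** * The continued fraction and its convergents *)

(* [gf_dilate k] is 1 + B(q^k x, q). *)
Definition gf_dilate k : Zqx := iter k dilate (gf calB).

Lemma gf_dilate_unit k : gf_dilate k \is a GRing.unit.
Proof.
rewrite fps_unitE; suff -> : gf_dilate k 0%N = 1 by exact: unitr1.
elim: k => [|k IHk]; first exact: gf0.
by rewrite /gf_dilate iterS /= -/(gf_dilate k) IHk mulr1.
Qed.

(** Dilation is a ring morphism, so it carries the equation at k to k+1, sending q^(k+1) x to
    q^(k+2) x. *)
Lemma gf_dilate_eq k :
  gf_dilate k * (1 + q_ ^+ k.+1 * x_) =
  1 + q_ ^+ k.+1 * x_ + q_ ^+ k.+1 * x_ * gf_dilate k.+1 * gf_dilate k.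
Proof.
elim: k => [|k IHk]; first by rewrite expr1 gf_calB_eq.
have step (y a b : Zqx) : a * (1 + y) = 1 + y + y * b * a ->
    dilate a * (1 + dilate y) = 1 + dilate y + dilate y * dilate b * dilate a.
  by move/(congr1 dilate); rewrite !(rmorphM, rmorphD, rmorph1).
have qxE : dilate (q_ ^+ k.+1 * x_) = q_ ^+ k.+2 * x_.
  by rewrite rmorphM rmorphXn /= fps_scaleC fps_scaleX -/q_ -/x_ mulrA -exprSr.
by have := step _ _ _ IHk; rewrite qxE.
Qed.

Lemma unit_1Dqx k : 1 + q_ ^+ k * x_ \is a GRing.unit.
Proof. exact: unit_add_x. Qed.

Definition cf_limit k : Zqx := (1 + q_ ^+ k * x_) / gf_dilate k.

Lemma cf_limit_unit k : cf_limit k \is a GRing.unit.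
Proof. by rewrite unitrM unitrV unit_1Dqx gf_dilate_unit. Qed.

(** This is [gf_dilate_eq] divided by [gf_dilate k] and by 1 + q^(k+1) x. It yields the recursion
    for F_k and, at k = 0, the outermost fraction. *)
Lemma gf_dilateV k : (gf_dilate k)^-1 = 1 - q_ ^+ k.+1 * x_ / cf_limit k.+1.
Proof.
have U := gf_dilate_unit k; apply: (mulrI U); rewrite mulrV //.
rewrite invrM ?unitrV ?gf_dilate_unit ?unit_1Dqx // invrK.
have := gf_dilate_eq k; have := unit_1Dqx k.+1.
move: {U} (gf_dilate k) (gf_dilate k.+1) (q_ ^+ k.+1 * x_).
move=> a b y Uu E.
apply: (mulIr Uu); rewrite mul1r mulrBr mulr1 mulrBl E !mulrA mulrVK //.
by ring.
Qed.

Lemma cf_limit_rec k :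
  cf_limit k = 1 + q_ ^+ k * x_
                 - (1 + q_ ^+ k * x_) * q_ ^+ k.+1 * x_ / cf_limit k.+1.
Proof. by rewrite {1}/cf_limit gf_dilateV mulrBr mulr1 !mulrA. Qed.

Lemma cf_tail_unit d k : cf_tail d k \is a GRing.unit.
Proof.
case: d => [|d] /=; first exact: unit_1Dqx.
by rewrite mulrAC -addrA -mulNr -mulrDl unit_add_x.
Qed.

(** Taking reciprocals preserves the order of the error, and the factor x in each layer raises it by
    one. *)
Lemma vanish_cf_tail d k : vanish d (cf_tail d k - cf_limit k).
Proof.
elim: d k => [|d IHd] k; first exact: vanish0.
have V := vanishBV (cf_tail_unit d k.+1) (cf_limit_unit k.+1) (IHd k.+1).
rewrite cf_limit_rec /=; set c := 1 + _.
have -> (t f : Zqx) : c - c * q_ ^+ k.+1 * x_ / t - (c - c * q_ ^+ k.+1 * x_ / f)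
    = x_ * (- (c * q_ ^+ k.+1) * (t^-1 - f^-1)).
  by set t' := t^-1; set f' := f^-1; ring.
exact/vanishX/vanishMl.
Qed.

Lemma genB_cf_limit : 1 + genB = 1 / (1 - q_ * x_ / cf_limit 1).
Proof. by rewrite genB_gf div1r -(gf_dilateV 0) invrK. Qed.

Lemma cf_convergent_cvg : fps_cvg cf_convergent (1 + genB).
Proof.
apply: vanish_cvg => d; rewrite genB_cf_limit /cf_convergent !div1r.
have U (t : Zqx) : 1 - q_ * x_ / t \is a GRing.unit.
  by rewrite mulrAC -mulNr unit_add_x.
apply: vanishBV => //.
have V := vanishBV (cf_tail_unit d 1) (cf_limit_unit 1) (@vanish_cf_tail d 1).
have -> (t f : Zqx) : 1 - q_ * x_ / t - (1 - q_ * x_ / f)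
    = x_ * (- q_ * (t^-1 - f^-1)).
  by set t' := t^-1; set f' := f^-1; ring.
(* The outermost layer gains one order more than required, so d+1 is weakened to d. *)
by have W := vanishX (@vanishMl _ d (- q_) _ V); move=> n /ltnW; apply: W.
Qed.

Lemma den_series_unit : den_series \is a GRing.unit.
Proof. by rewrite fps_unitE /= subr0 unitr1. Qed.

Theorem theorem4p1 :
  [/\ genB =
        (\fsum_(1 <= j)
           ((-1) ^+ (j - 1) * q_ ^+ j * x_ ^+ j *
            \prod_(1 <= i < j)
              ((1 - q_ ^+ i + q_ ^+ (2 * i)) / (1 - q_ ^+ i)))) /
        (1 - \fsum_(1 <= j)
           ((-1) ^+ (j - 1) * (q_ ^+ j * x_ ^+ j / (1 - q_ ^+ j)) *
            \prod_(1 <= i < j)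
              ((1 - q_ ^+ i + q_ ^+ (2 * i)) / (1 - q_ ^+ i)))),
      fps_cvg cf_convergent (1 + genB)
    & exists F : nat -> Zqx,
        [/\ forall k : nat, (1 <= k)%N -> F k \is a GRing.unit,
            forall k : nat, (1 <= k)%N -> fps_cvg (fun d => cf_tail d k) (F k),
            forall k : nat, (1 <= k)%N ->
              F k = 1 + q_ ^+ k * x_
                      - (1 + q_ ^+ k * x_) * q_ ^+ k.+1 * x_ / F k.+1
          & 1 + genB = 1 / (1 - q_ * x_ / F 1%N)]].
Proof.
split; last 1 first.
- exists cf_limit; split=> [k _|k _|k _|].
  + exact: cf_limit_unit.
  + by apply: vanish_cvg => d; exact: vanish_cf_tail.
  + exact: cf_limit_rec.
  + exact: genB_cf_limit.
- rewrite num_seriesE den_seriesE; have U := den_series_unit.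
  (* After clearing the denominator, B D = A D - D = D(qx) - D(x), which is the numerator. *)
  apply: (mulIr U); rewrite mulrVK // -[genB](addKr 1) genB_gf mulrDl.
  by rewrite gf_calB_den -num_series_dilate mulN1r addrC addrK.
- exact: cf_convergent_cvg.
Qed.
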